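(* For every real number $\zeta>\frac{41}{2}$ there exists a positive integer $c=c(\zeta)$ such that every bipartite graph $G$ with maximum degree $\Delta(G)\ge c$ and $|V(G)|\ge \zeta\,\Delta(G)$ satisfies $$\chi_e(G)\le \left\lceil \frac{\Delta(G)}{2}\right\rceil+1.$$
   Context: Graphs have finite vertex sets, no loops, and no parallel edges. $\Delta(G)$ denotes the maximum degree of $G$. A proper $k$-coloring of $G$ (an assignment of colors from a set of $k$ colors to the vertices in which adjacent vertices get distinct colors) is equitable if the sizes of any two of its $k$ color classes differ by at most one. The equitable chromatic number $\chi_e(G)$ is the smallest integer $k$ such that $G$ admits an equitable $k$-coloring. *)

(* Defs.v *)
From mathcomp Require Import all_boot all_order all_algebra.
From mathcomp Require Import reals.

Set Implicit Arguments.
Unset Strict Implicit.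
Unset Printing Implicit Defensive.

Record sgraph := SGraph {
  vertex :> finType;
  adj : rel vertex;
  adj_sym : symmetric adj;
  adj_irr : irreflexive adj }.

Definition degree (G : sgraph) (v : G) : nat := #|[set w | adj v w]|.

Definition max_degree (G : sgraph) : nat := \max_(v : G) degree v.

Definition bipartite (G : sgraph) : Prop :=
  exists A : {set G}, forall x y : G, adj x y -> (x \in A) != (y \in A).

Definition proper_coloring (G : sgraph) (k : nat) (f : {ffun G -> 'I_k}) : bool :=
  [forall x, forall y, adj x y ==> (f x != f y)].

Definition color_class (G : sgraph) (k : nat) (f : {ffun G -> 'I_k}) (i : 'I_k)
  : {set G} := [set x | f x == i].

(* All k colors count, including unused ones (whose class is empty); since i
   and j range over all ordered pairs, this bounds the absolute difference. *)
Definition equitable (G : sgraph) (k : nat) (f : {ffun G -> 'I_k}) : bool :=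
  [forall i, forall j, #|color_class f i| <= #|color_class f j| + 1].

Definition equitably_colorable (G : sgraph) (k : nat) : bool :=
  [exists f : {ffun G -> 'I_k}, proper_coloring f && equitable f].

(* The coloring giving all vertices distinct colors is equitable. *)
Lemma equitably_colorable_card (G : sgraph) : equitably_colorable G #|G|.
Proof.
apply/existsP; exists [ffun x : G => enum_rank x]; apply/andP; split.
  apply/forallP=> x; apply/forallP=> y; apply/implyP=> xy.
  rewrite !ffunE; apply: contraTneq xy => /enum_rank_inj->.
  by rewrite adj_irr.
apply/forallP=> i; apply/forallP=> j; apply: leq_trans (leq_addl _ _).
rewrite -(cards1 (enum_val i)); apply: subset_leq_card.
by apply/subsetP=> x; rewrite !inE ffunE => /eqP<-; rewrite enum_rankK.
Qed.

Lemma ex_equitably_colorable (G : sgraph) : exists k, equitably_colorable G k.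
Proof. by exists #|G|; apply: equitably_colorable_card. Qed.

Definition equitable_chromatic_number (G : sgraph) : nat :=
  ex_minn (ex_equitably_colorable G).

(* Main.v *)
(* Let A be the smaller side of the bipartition, D the maximum degree, n the
   number of vertices, k = uphalf D + 1 and s = n %/ k, so that D * s < 2 * n.
   Fill as many classes as possible with vertices of A alone; at most s vertices
   of A remain. Spread them over eight mixed classes: each receives at most
   (s + 7) / 8 of them, so it forbids at most D * (s + 7) / 8, about n / 4, of the
   at least n / 2 vertices of the other side. What is left is far more than the
   8 * (s + 1) vertices needed to complete the eight classes greedily, and the
   remaining vertices of the other side fill the remaining classes. *)
Require Import Defs.
From mathcomp Require Import all_boot all_order all_algebra.
From mathcomp Require Import zify reals.
Import Order.TTheory GRing.Theory Num.Theory.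

Lemma exists_subset_card (T : finType) (A : {set T}) (m : nat) :
  m <= #|A| -> exists2 B : {set T}, B \subset A & #|B| = m.
Proof.
move=> mA; exists [set x in take m (enum A)].
  by apply/subsetP => x; rewrite inE => /mem_take; rewrite mem_enum.
rewrite cardsE (card_uniqP (take_uniq m (enum_uniq _))) size_take -cardE.
by case: ltngtP mA.
Qed.

(** Induction on [k]: the earlier labels occupy [\sum_(j < k) b j] elements, so if [b k] is nonzero,
    the prefix-sum bound leaves at least [b k] elements of [S :&: N k] free for label [k]. A value
    of [f] not below [k] means unlabelled. *)
Lemma greedy_labelling (T : finType) (S : {set T}) (b : nat -> nat)
    (N : nat -> {set T}) (k : nat) :
    (forall i, i < k -> b i = 0 \/ \sum_(j < i.+1) b j <= #|S :&: N i|) ->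
  exists f : T -> nat,
    [/\ forall i, i < k -> #|[set x in S | f x == i]| = b i,
        #|[set x in S | f x < k]| = \sum_(i < k) b i
      & forall x, x \in S -> f x < k -> x \in N (f x)].
Proof.
elim: k => [|k IHk] Nk.
  exists (fun=> 0); split=> //; rewrite big_ord0.
  by apply/eqP; rewrite cards_eq0; apply/eqP/setP => x; rewrite !inE andbF.
have [f [fb fsum fN]] := IHk (fun i ik => Nk i (leqW ik)).
set U := [set x in S | f x < k] in fsum.
have [|Y YN cardY] := @exists_subset_card T ((S :&: N k) :\: U) (b k).
  case: (Nk k (ltnSn k)) => [->//|]; rewrite big_ord_recr /= -fsum => Nkb.
  have := cardsID U (S :&: N k).
  have := subset_leq_card (subsetIr (S :&: N k) U).
  by lia.
have YP x : x \in Y -> [/\ x \in S, x \in N k & k <= f x].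
  move=> /(subsetP YN); rewrite !inE => /andP[fx /andP[xS xN]].
  by move: fx; rewrite xS -leqNgt.
(* Elements still unlabelled get [k.+1], because [k] has just become a label. *)
exists (fun x => if x \in Y then k else if f x < k then f x else k.+1); split.
- move=> i; rewrite ltnS leq_eqVlt => /predU1P[-> | ik].
    rewrite -cardY; apply: eq_card => x; rewrite !inE.
    case: ifPn => [/YP[-> _ _]|_]; rewrite ?eqxx //.
    by case: ifP => fx; apply/negbTE; rewrite negb_and; lia.
  rewrite -fb //; apply: eq_card => x; rewrite !inE.
  case: ifPn => [/YP[-> _ fx]|_] /=; first by lia.
  by case: (x \in S) => //=; case: ifP => fx; lia.
- rewrite big_ord_recr /= -fsum -cardY addnC -cardsUI.
  rewrite (_ : Y :&: U = set0) ?cards0 ?addn0; last first.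
    apply/setP => x; rewrite !inE; apply: contraTF isT => /andP[/YP[_ _ fx]].
    by lia.
  apply: eq_card => x; rewrite !inE; case: ifPn => [/YP[-> _ fx]|_] /=.
    by rewrite ltnSn.
  by case: (x \in S) => //=; case: ifP => fx; lia.
- move=> x xS; case: ifPn => [/YP[]//|_]; case: ifP => fx; last by rewrite ltnn.
  by move=> _; apply: fN.
Qed.

(** Since the [b i] add up to [#|S|], the greedy labelling exhausts [S]. If [S \subset N i], the
    prefix-sum bound is automatic, as no prefix sum exceeds [#|S|]. *)
Lemma greedy_partition (T : finType) (S : {set T}) (b : nat -> nat)
    (N : nat -> {set T}) (k : nat) :
    \sum_(i < k) b i = #|S| ->
    (forall i, i < k ->
       [\/ b i = 0, S \subset N i | \sum_(j < i.+1) b j <= #|S :&: N i|]) ->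
  exists f : T -> nat,
    [/\ forall x, x \in S -> f x < k,
        forall i, i < k -> #|[set x in S | f x == i]| = b i
      & forall x, x \in S -> x \in N (f x)].
Proof.
move=> sumb Nk; have [i ik|f [fb fsum fN]] := @greedy_labelling T S b N k.
  case: (Nk i ik) => [|SN|]; [by left| |by right].
  right; rewrite (setIidPl SN) -sumb -!(big_mkord xpredT b).
  by rewrite [X in _ <= X](big_cat_nat (leq0n i.+1) ik) leq_addr.
have fk x : x \in S -> f x < k.
  have /eqP <- : [set x in S | f x < k] == S.
    rewrite eqEcard fsum sumb leqnn andbT.
    by apply/subsetP => y; rewrite inE => /andP[].
  by rewrite inE => /andP[].
by exists f; split=> // x xS; apply: fN (fk x xS).
Qed.

Definition neighbourhood (G : sgraph) (X : {set G}) : {set G} :=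
  \bigcup_(x in X) [set y | adj x y].

Lemma card_neighbourhood (G : sgraph) (X : {set G}) :
  #|neighbourhood G X| <= #|X| * max_degree G.
Proof.
rewrite /neighbourhood -sum_nat_const.
elim/big_rec2: _ => [|x m U _ Um]; first by rewrite cards0.
apply: leq_trans (leq_card_setU _ _) (leq_add _ Um).
exact: (leq_bigmax x).
Qed.

(** Class [i] is to have [s i] vertices, [a i] of them in [A]. Split [A] arbitrarily, then complete
    the classes greedily from the other side, avoiding the at most [a i * max_degree G] neighbours
    of the part of [A] in class [i]. Classes within one side meet no obstruction. *)
Lemma coloring_of_sizes (G : sgraph) (A : {set G}) (k : nat) (a s : nat -> nat) :
    (forall x y : G, adj x y -> (x \in A) != (y \in A)) ->
    (forall i, i < k -> a i <= s i) ->
    \sum_(i < k) a i = #|A| -> \sum_(i < k) s i = #|G| ->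
    (forall i, i < k ->
       [\/ a i = 0, a i = s i
         | \sum_(j < i.+1) s j + a i * max_degree G <= #|~: A|]) ->
  exists f : G -> nat,
    [/\ forall x, f x < k, forall x y : G, adj x y -> f x != f y
      & forall i, i < k -> #|[set x | f x == i]| = s i].
Proof.
move=> bipA leas suma sums mixed.
have [|f [fk fa _]] := @greedy_partition G A a (fun=> setT) k suma.
  by move=> i _; apply: Or32; apply/subsetP => x; rewrite inE.
pose X i := [set x in A | f x == i].
have sumb : \sum_(i < k) (s i - a i) = #|~: A|.
  have := cardsC A; rewrite -sums -suma.
  rewrite -(eq_bigr _ (fun (i : 'I_k) _ => subnKC (leas i (ltn_ord i)))).
  by rewrite big_split /=; lia.
have [|g [gk gb gN]] := @greedy_partition G (~: A) (fun i => s i - a i)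
    (fun i => ~: neighbourhood G (X i)) k sumb.
  move=> i ik; have [a0|->|le] := mixed i ik; last 2 first.
  - by apply: Or31; rewrite subnn.
  - apply: Or33; rewrite -setDE.
    have := card_neighbourhood G (X i); rewrite fa //.
    have := cardsID (neighbourhood G (X i)) (~: A).
    have := subset_leq_card (subsetIr (~: A) (neighbourhood G (X i))).
    have : \sum_(j < i.+1) (s j - a j) <= \sum_(j < i.+1) s j.
      by apply: leq_sum => j _; apply: leq_subr.
    by lia.
  apply: Or32; have /eqP := fa i ik; rewrite a0 cards_eq0 => /eqP X0.
  by rewrite /X X0 /neighbourhood big_set0 setC0 subsetT.
have fg x y : x \in A -> y \notin A -> adj x y -> f x != g y.
  move=> xA yA xy; have := gN y; rewrite !inE => /(_ yA); apply: contraNneq => fgxy.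
  by apply/bigcupP; exists x; rewrite !inE // xA fgxy eqxx.
exists (fun x => if x \in A then f x else g x); split.
- by move=> x; case: ifPn => xA; [apply: fk | apply: gk; rewrite inE].
- move=> x y xy; have := bipA x y xy.
  case: ifPn => xA; case: ifPn => yA // _; first exact: fg.
  by rewrite eq_sym; apply: fg => //; rewrite adj_sym.
- move=> i ik; rewrite -(subnKC (leas i ik)) -(gb i ik) -(fa i ik).
  rewrite -cardsUI (_ : _ :&: _ = set0) ?cards0 ?addn0; last first.
    by apply/setP => x; rewrite !inE; case: (x \in A); rewrite ?andbF.
  apply: eq_card => x; rewrite !inE.
  by case: (x \in A); rewrite ?orbF.
Qed.

Lemma equitable_of_sizes (G : sgraph) (k s : nat) (sz : nat -> nat) (f : G -> nat) :
    (forall x, f x < k) -> (forall x y : G, adj x y -> f x != f y) ->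
    (forall i, i < k -> #|[set x | f x == i]| = sz i) ->
    (forall i, s <= sz i <= s.+1) ->
  equitably_colorable G k.
Proof.
move=> fk fadj fsz sz_s.
have class (i : 'I_k) :
    #|color_class [ffun x => Ordinal (fk x)] i| = sz i.
  rewrite -(fsz i (ltn_ord i)); apply: eq_card => x.
  by rewrite !inE ffunE -val_eqE.
apply/existsP; exists [ffun x => Ordinal (fk x)]; apply/andP; split.
  apply/forallP => x; apply/forallP => y; apply/implyP => xy.
  by rewrite !ffunE -val_eqE /=; apply: fadj.
apply/forallP => i; apply/forallP => j; rewrite !class.
by have := sz_s i; have := sz_s j; lia.
Qed.

(* Classes below 8 are the mixed ones: [(x + i) %/ 8] for [i < 8] splits [x]
   into eight nearly equal parts. *)
Definition small_side_sizes (sz : nat -> nat) (x j i : nat) : nat :=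
  if i < 8 then (x + i) %/ 8 else if i < 8 + j then sz i else 0.

Lemma sum_small_side_sizes (sz : nat -> nat) (x j k : nat) : 8 + j <= k ->
  \sum_(i < k) small_side_sizes sz x j i = x + \sum_(8 <= i < 8 + j) sz i.
Proof.
move=> jk; rewrite -(big_mkord xpredT (small_side_sizes sz x j)).
rewrite (big_cat_nat (leq0n (8 + j)) jk) /=.
rewrite (big_cat_nat (leq0n 8) (leq_addr j 8)) /=.
rewrite [X in _ + X]big1_seq ?addn0; last first.
  move=> i /andP[_]; rewrite mem_index_iota /small_side_sizes => ij.
  by do 2![case: ifP => ?; first by lia].
congr (_ + _).
  (* Hermite's identity: the eight floors [(x + i) %/ 8] add up to [x]. *)
  by rewrite unlock /= /small_side_sizes /=; lia.
apply: eq_big_nat => i ij; rewrite /small_side_sizes.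
by case: ifP => ?; first lia; case: ifP => ? //; lia.
Qed.

Lemma equitably_colorable_bipartite (G : sgraph) (A : {set G}) :
    (forall x y : G, adj x y -> (x \in A) != (y \in A)) -> #|A| <= #|~: A| ->
    160 <= max_degree G -> 41 * max_degree G <= 2 * #|G| ->
  equitably_colorable G (uphalf (max_degree G) + 1).
Proof.
set D := max_degree G; set n := #|G|; set k := uphalf D + 1.
move=> bipA leAB D_ge leDn.
have Dk : D + 2 <= 2 * k /\ 2 * k <= D + 3 by rewrite /k; lia.
have cardA : #|A| + #|~: A| = n by apply: cardsC.
clearbody k; set s := n %/ k; set r := n %% k.
have def_n : n = s * k + r by apply: divn_eq.
have rk : r < k by rewrite ltn_mod; lia.
have s_gt0 : 0 < s by rewrite divn_gt0; lia.
clearbody s r.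
(* As [n = s * k + r], the first [r] classes get one extra vertex. *)
pose sz i := s + (i < r).
have sz_s i : s <= sz i <= s.+1 by rewrite /sz; lia.
have sum_sz : \sum_(i < k) sz i = n.
  rewrite def_n big_split /= sum_nat_const card_ord mulnC; congr (_ + _).
  rewrite -(big_mkord xpredT (fun i => (i < r) : nat)).
  rewrite (big_cat_nat (leq0n r) (ltnW rk)) /= big_nat [X in _ + X]big_nat.
  rewrite (eq_bigr (fun=> 1)) => [|i /andP[_ ->] //].
  rewrite [X in _ + X]big1 => [|i /andP[ri _]]; last by rewrite ltnNge ri.
  by rewrite -big_nat sum_nat_const_nat; lia.
have prefix_le m : \sum_(i < m) sz i <= m * s.+1.
  rewrite -[X in _ <= X * _]card_ord -sum_nat_const.
  by apply: leq_sum => i _; case/andP: (sz_s i).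
have leDs : D * s + 2 * s <= 2 * n.
  have := leq_mul Dk.1 (leqnn s); rewrite def_n; lia.
(* From [160 * s <= D * s <= 2 * n]: eight classes take only about a tenth of all vertices. *)
have les : 80 * s <= n by have := leq_mul D_ge (leqnn s); lia.
have len : 1640 <= n by lia.
pose P j := \sum_(8 <= i < 8 + j) sz i.
have sumP : \sum_(i < 8) sz i + P (k - 8) = n.
  rewrite /P subnKC; last by lia.
  rewrite -sum_sz -!(big_mkord xpredT sz).
  by rewrite [RHS](big_cat_nat (leq0n 8) (_ : 8 <= k)) //; lia.
(* The mixed classes hold at most [8 * s.+1] vertices, less than half of [n], and [A] has at most
   half. *)
have Pk : #|A| < P (k - 8) by have := prefix_le 8; lia.
(* By minimality of [j.+1], [A] fills [j] classes after the mixed ones, and the remainder [x] is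
   less than the size of one more class, hence at most [s]. *)
have [[|j] Pj_gt Pj_min] := ex_minnP (ex_intro (fun j => #|A| < P j) _ Pk).
  by move: Pj_gt; rewrite /P addn0 big_geq.
have Pj_le : P j <= #|A|.
  by rewrite leqNgt; apply/negP => /Pj_min; rewrite ltnn.
have PjS : P j.+1 = P j + sz (8 + j) by rewrite /P addnS big_nat_recr ?leq_addr.
pose x := #|A| - P j.
have jk : 8 + j <= k by have := Pj_min _ Pk; lia.
have xs : x <= s by have := sz_s (8 + j); rewrite /x; lia.
have [||||f [fk fadj fsz]] :=
    @coloring_of_sizes G A k (small_side_sizes sz x j) sz bipA.
- move=> i ik; rewrite /small_side_sizes; have := sz_s i.
  by case: ifP => i8; [lia | case: ifP].
- by rewrite sum_small_side_sizes // subnK.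
- exact: sum_sz.
- move=> i ik; rewrite /small_side_sizes; case: ifP => i8; last first.
    by case: ifP => _; [apply: Or32 | apply: Or31].
  (* It suffices that [8 * s.+1 + D * (s + 7) / 8] is at most [n / 2]. Here [D * s / 8] is at most
     [n / 4], and the other terms are small by [les], [leDn] and [len]. *)
  apply: Or33; rewrite -/D; have := prefix_le i.+1.
  have : (x + i) %/ 8 * D * 8 <= (s + 7) * D by rewrite mulnAC leq_mul2r; lia.
  by nia.
exact: equitable_of_sizes fk fadj fsz sz_s.
Qed.

Local Open Scope ring_scope.

Theorem theorem1p2 (R : realType) (zeta : R) (hzeta : 41%:R / 2%:R < zeta) :
  exists c : nat, (0 < c)%N /\
    forall G : sgraph,
      bipartite G ->
      (c <= max_degree G)%N ->
      zeta * (max_degree G)%:R <= #|G|%:R ->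
      (equitable_chromatic_number G <= uphalf (max_degree G) + 1)%N.
Proof.
exists 160%N; split=> // G [A bipA] D_ge leDn.
have {}leDn : (41 * max_degree G <= 2 * #|G|)%N.
  rewrite -(ler_nat R) !natrM -ler_pdivrMl ?ltr0n // mulrA [_^-1 * _]mulrC.
  by apply: le_trans leDn; rewrite ler_wpM2r ?ler0n // ltW.
rewrite /equitable_chromatic_number; case: ex_minnP => m _; apply.
(* The two sides play symmetric roles, so the smaller one can serve as [A]. *)
have [leAB|/ltnW leBA] := leqP #|A| #|~: A|.
  exact: equitably_colorable_bipartite bipA leAB D_ge leDn.
apply: (@equitably_colorable_bipartite G (~: A)) => //; last by rewrite setCK.
by move=> x y /bipA; rewrite !inE (inj_eq negb_inj).
Qed.
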